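(* Assume that there exist positive constants $M$, $V_1$ and $V_2$ such that (almost surely) $$G_{X_1}(X_1)\le M,\quad G_\varepsilon(\varepsilon)\le M,\quad\mathbb E\big[(G_{X_1}(X_1))^2\big]\le V_1\quad\text{and}\quad\mathbb E\big[(G_\varepsilon(\varepsilon))^2\big]\le V_2.$$ Let $V=V_1(K_{n-1}(\rho))^2+V_2\sum_{i=2}^n(K_{n-i}(\rho))^2$. Then, for any $x>0$, $$\mathbb P(\pm S_n>x)\le H_n\left(\frac{x}{MK_{n-1}(\rho)},\frac{\sqrt V}{MK_{n-1}(\rho)}\right),$$ where $$H_n(x,v)=\left\{\Big(\frac{v^2}{x+v^2}\Big)^{x+v^2}\Big(\frac{n}{n-x}\Big)^{n-x}\right\}^{\frac{n}{n+v^2}}\mathbf 1_{\{x\le n\}}$$ with the convention that $(+\infty)^0=1$ (which applies when $x=n$).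
   Context: $(\mathcal X,d)$ and $(\mathcal Y,\delta)$ are complete separable metric spaces; $(\varepsilon_i)_{i\ge1}$ is a sequence of iid $\mathcal Y$-valued random variables; $X_1$ is an $\mathcal X$-valued random variable independent of $(\varepsilon_i)_{i\ge2}$. The Markov chain is $X_n=F(X_{n-1},\varepsilon_n)$ for $n\ge2$, where $F:\mathcal X\times\mathcal Y\to\mathcal X$ is measurable and satisfies, for some $\rho\in[0,1)$ and $C>0$, $\mathbb E[d(F(x,\varepsilon_1),F(x',\varepsilon_1))]\le\rho\,d(x,x')$ for all $x,x'\in\mathcal X$, and $d(F(x,y),F(x,y'))\le C\,\delta(y,y')$ for all $x\in\mathcal X$, $y,y'\in\mathcal Y$. Fix $n\ge1$ and $f:\mathcal X^n\to\mathbb R$ with $|f(x_1,\ldots,x_n)-f(x_1',\ldots,x_n')|\le d(x_1,x_1')+\cdots+d(x_n,x_n')$, and let $S_n=f(X_1,\ldots,X_n)-\mathbb E[f(X_1,\ldots,X_n)]$. Let $P_{X_1}$ be the law of $X_1$, $P_\varepsilon$ the common law of the $\varepsilon_k$'s, $G_{X_1}(x)=\int d(x,x')P_{X_1}(dx')$, $G_\varepsilon(y)=\int C\,\delta(y,y')P_\varepsilon(dy')$; $G_\varepsilon(\varepsilon)$ denotes a random variable distributed as $G_\varepsilon(\varepsilon_k)$. For $k\in\mathbb N$, $K_k(\rho)=1+\rho+\cdots+\rho^k$. Statements with $\pm$ hold for each of the two signs. *)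

(* Defs.v *)
From HB Require Import structures.
From mathcomp Require Export all_boot all_order all_algebra.
From mathcomp Require Export finmap.
From mathcomp Require Export all_classical all_reals all_analysis.

Set Implicit Arguments.
Unset Strict Implicit.
Unset Printing Implicit Defensive.

Import Order.TTheory GRing.Theory Num.Theory.
Import numFieldNormedType.Exports.

Local Open Scope classical_set_scope.
Local Open Scope ring_scope.

(* The library's [Complete] includes a distinguished point; this is harmless
   here, since a space carrying a random variable is nonempty. *)
#[short(type="completeMetricType")]
HB.structure Definition CompleteMetric (K : numDomainType) :=
  {T of Complete T & Metric K T}.

Definition separable (T : topologicalType) : Prop :=
  exists2 D : set T, countable D & dense D.

Notation borelType T := (g_sigma_algebraType (@open T)).

Definition mutually_independent d d' (Omega : measurableType d)
    (T : measurableType d') (R : realType) (P : probability Omega R)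
    (I : choiceType) (D : set I) (Z : I -> {RV P >-> T}) : Prop :=
  forall (J : {fset I}) (A : I -> set T),
    [set` J] `<=` D -> (forall i, measurable (A i)) ->
    P (\bigcap_(i in [set` J]) (Z i @^-1` A i)) =
    (\prod_(i <- J) P (Z i @^-1` A i))%E.

Definition identically_distributed d d' (Omega : measurableType d)
    (T : measurableType d') (R : realType) (P : probability Omega R)
    (I : Type) (D : set I) (Z : I -> {RV P >-> T}) : Prop :=
  forall i j, D i -> D j -> forall A : set T, measurable A ->
    distribution P (Z i) A = distribution P (Z j) A.

Definition generated_sigma_algebra d d' (Omega : measurableType d)
    (T : measurableType d') (I : Type) (D : set I) (Z : I -> Omega -> T) :
    set (set Omega) :=
  <<s \bigcup_(i in D) preimage_set_system setT (Z i) measurable >>.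

Definition independent_of_family d d1 d2 (Omega : measurableType d)
    (T1 : measurableType d1) (T2 : measurableType d2) (R : realType)
    (P : probability Omega R) (W : {RV P >-> T1})
    (I : Type) (D : set I) (Z : I -> {RV P >-> T2}) : Prop :=
  forall (A : set T1) (E : set Omega), measurable A ->
    generated_sigma_algebra D (fun i => Z i : Omega -> T2) E ->
    P ((W @^-1` A) `&` E) = (P (W @^-1` A) * P E)%E.

(* [c * E d(x, Z)], the integral being taken under the law of [Z]: [G_{X_1}]
   is the case [c = 1], [Z = X_1], and [G_eps] the case [c = C], [Z = eps_1]. *)
Definition mean_distance d (Omega : measurableType d) (R : realType)
    (P : probability Omega R) (T : completeMetricType R) (c : R)
    (Z : {RV P >-> borelType T}) (x : T) : \bar R :=
  (\int[distribution P Z]_x' (c * mdist x x')%:E)%E.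

Definition geometric_sum (R : realType) (rho : R) (k : nat) : R :=
  \sum_(0 <= j < k.+1) rho ^+ j.

(* At [x = n] the second factor is [(n / 0) `^ 0], which the library evaluates
   to [1], in accordance with the convention [(+oo)^0 = 1]. *)
Definition Hfun (R : realType) (n : nat) (x v : R) : R :=
  if x <= n%:R then
    (((v ^+ 2 / (x + v ^+ 2)) `^ (x + v ^+ 2)) *
     ((n%:R / (n%:R - x)) `^ (n%:R - x))) `^ (n%:R / (n%:R + v ^+ 2))
  else 0.

Definition centered d (Omega : measurableType d) (R : realType)
    (P : probability Omega R) (Z : Omega -> R) (w : Omega) : R :=
  Z w - fine ('E_P[Z])%E.

(* Main.v *)
From HB Require Import structures.
Require Import Defs.
From mathcomp Require Import all_boot all_order all_algebra.
From mathcomp Require Import all_classical all_reals all_analysis.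
From mathcomp Require Import measurable_realfun zify ring lra.

Set Implicit Arguments.
Unset Strict Implicit.
Unset Printing Implicit Defensive.

Import Order.TTheory GRing.Theory Num.Theory.
Import numFieldNormedType.Exports.

Local Open Scope classical_set_scope.
Local Open Scope ring_scope.

(** Let m = M K_(n-1) and xi = (f(X_1, ..., X_n) - E f(X_1, ..., X_n)) / m.
Integrating out the innovations one after the other, the last one first, writes
xi as a sum of n martingale differences. If a functional of the first k + 1
states is 1-Lipschitz in the first k of them and L-Lipschitz in the last one,
then integrating out the last innovation gives a functional of k states whose
constant in its own last state is 1 + rho L: the contraction in mean turns L
into rho L, and the previous Lipschitz constant 1 is added
([average_lipschitz]). Starting from L = 1, the constants are
K_0, K_1, ..., K_(n-1).

Given the past, the difference due to the innovation eps_i is a Lipschitz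
function of eps_i minus its mean. It is therefore at most
K_(n-i) G_eps(eps_i) / m in absolute value ([lipschitz_deviation]), hence at
most 1, with conditional variance at most sigma_i = V_2 K_(n-i)^2 / m^2; for X_1
the same holds with V_1 K_(n-1)^2 / m^2. The sum of these n bounds on variances
is n s, where n s m^2 = V.

For t > 0 there is a parabola a + b x + c x^2 with c >= 0 that lies above
exp(t x) on x <= 1 and agrees with it at the two atoms -s and 1 of the centered
law of variance s ([expR_le_parabola]). Integrating it bounds the conditional
moment generating function of the i-th difference by a + c sigma_i
([mgf_le_parabola]). One and the same parabola, the one of the average variance
s, serves for all the differences: the bounds are affine in the variance, so by
the inequality between arithmetic and geometric means their product is at most
(a + c s)^n ([prod_parabola_le]), which is the n-th power of the moment
generating function of the two-point law. Markov's inequality and the optimal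
choice of t give H_n(x / m, sqrt V / m) when x < n m ([Hfun_chernoff]). For x >=
n m the event is negligible since every difference is almost surely at most 1.

The induction along the chain ([chain_concentration]) is over all the Lipschitz
functionals at once. The past up to time k is the space Omega with the smaller
sigma-algebra generated by X_1, eps_2, ..., eps_k, so that conditioning on it is
Fubini's theorem for the pair formed by the past and eps_(k+1), which are
independent ([history_independent]). *)

(** * Exponentials, parabolas and the function H *)

(** On [0, T] the exponential lies below its chord, and to the left of 0 it lies
above the extended chord; the factor l carries this change of sign. The
expression is the derivative in T of the defect in [expR_remainder_scale]. *)
Lemma expR_chord (R : realType) (l T : R) : l <= 1 -> 0 <= T ->
  0 <= l * (l * (expR T - 1) - (expR (l * T) - 1)).
Proof.
move=> l1 T0; have [l0|l0] := leP 0 l.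
- rewrite mulr_ge0// subr_ge0.
  have h1 : expR (l * T) * (1 + (1 - l) * T) <= expR T.
    rewrite [leRHS](_ : _ = expR (l * T) * expR ((1 - l) * T));
      last by rewrite -expRD; congr expR; ring.
    by rewrite ler_wpM2l ?expR_ge0 ?expR_ge1Dx.
  have h2 : expR (l * T) * (1 + - (l * T)) <= 1.
    rewrite [leRHS](_ : _ = expR (l * T) * expR (- (l * T)));
      last by rewrite -expRD subrr expR0.
    by rewrite ler_wpM2l ?expR_ge0 ?expR_ge1Dx.
  set E := expR (l * T) in h1 h2 *.
  have := lerD (ler_wpM2l l0 h1) (ler_wpM2l (_ : 0 <= 1 - l) h2).
  rewrite subr_ge0 => /(_ l1) h3.
  have : E <= l * expR T + (1 - l) * 1.
    apply: le_trans h3; rewrite le_eqVlt; apply/orP; left; apply/eqP.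
    by ring.
  lra.
- apply: mulr_le0; first exact: ltW.
  rewrite subr_le0.
  have h1 := expR_ge1Dx (l * T).
  have h2 := expR_ge1Dx T.
  nra.
Qed.

(** This is the monotonicity of u |-> (exp u - 1 - u) / u^2, compared at u = l T
and at T, with the denominators cleared so that u = 0 needs no separate case. *)
Lemma expR_remainder_scale (R : realType) (l T : R) : l <= 1 -> 0 <= T ->
  expR (l * T) - 1 - l * T <= l ^+ 2 * (expR T - 1 - T).
Proof.
move=> l1 T0.
pose g := fun T : R => l ^+ 2 * (expR T - 1 - T) - (expR (l * T) - 1 - l * T).
have dg (y : R) : is_derive y 1 g (l * (l * (expR y - 1) - (expR (l * y) - 1))).
  rewrite /g; apply: is_derive_eq; rewrite /GRing.scale/=.
  ring.
have : g 0 <= g T.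
  apply: (@ger0_derive1_ndecry _ g 0) => //.
  - by move=> y; rewrite in_itv/= andbT => y0;
      rewrite derive1E derive_val expR_chord// ltW.
  - apply: derivable_within_continuous => y _;
      exact: (@ex_derive _ _ _ _ _ _ _ (dg y)).
by rewrite /g mulr0 expR0 !subr0 subrr mulr0 subr0 subr_ge0.
Qed.

(** The moment generating function at t of the law with mass 1 / (1 + s) at -s
and s / (1 + s) at 1, which is centered with variance s: the extremal law among
those with these two moments that are bounded above by 1. *)
Definition two_point_mgf (R : realType) (s t : R) : R :=
  (expR (- (t * s)) + s * expR t) / (1 + s).

(** The parabola tangent to x |-> exp(t x) at -s and meeting it again at 1.
A centered variable xi <= 1 of variance at most sigma then satisfies
E exp(t xi) <= a + c sigma, with equality at sigma = s for the two-point law. *)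
Lemma expR_le_parabola (R : realType) (s t : R) : 0 < s -> 0 <= t ->
  exists a b c : R, [/\ 0 <= c, a + c * s = two_point_mgf s t,
    forall x, 0 <= a + b * x + c * x ^+ 2 &
    forall x, x <= 1 -> expR (t * x) <= a + b * x + c * x ^+ 2].
Proof.
move=> s0 t0.
have s1 : 1 + s != 0 by rewrite gt_eqF// addr_gt0.
pose T := t * (1 + s); pose E := expR T - 1 - T; pose e := expR (- (t * s)).
have T0 : 0 <= T by rewrite mulr_ge0// ltW// addr_gt0.
have E0 : 0 <= E by rewrite /E -addrA -opprD subr_ge0 expR_ge1Dx.
have e0 : 0 <= e by exact: expR_ge0.
have D0 : 0 < (1 + s) ^+ 2 by rewrite exprn_gt0// addr_gt0.
pose a := e * (1 + t * s + s ^+ 2 * E / (1 + s) ^+ 2).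
pose b := e * (t + 2 * s * E / (1 + s) ^+ 2).
pose c := e * E / (1 + s) ^+ 2.
have c0 : 0 <= c by apply: divr_ge0; [exact: mulr_ge0|exact: ltW].
have expR_le x : x <= 1 -> expR (t * x) <= a + b * x + c * x ^+ 2.
  move=> x1.
  have l1 : (x + s) / (1 + s) <= 1.
    by rewrite ler_pdivrMr ?addr_gt0// mul1r lerD2r.
  have := expR_remainder_scale l1 T0.
  have -> : (x + s) / (1 + s) * T = t * (x + s) by rewrite /T; field.
  rewrite -/E => h.
  have -> : expR (t * x) = e * expR (t * (x + s)).
    by rewrite -expRD; congr expR; ring.
  have : e * expR (t * (x + s)) <=
      e * (1 + t * (x + s) + ((x + s) / (1 + s)) ^+ 2 * E).
    by rewrite ler_wpM2l//; lra.
  move=> /le_trans; apply; rewrite le_eqVlt; apply/orP; left; apply/eqP.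
  by rewrite /a /b /c; field.
exists a, b, c; split => //.
- have -> : two_point_mgf s t = e * (1 + s * expR T) / (1 + s).
    rewrite /two_point_mgf; congr (_ / _).
    rewrite mulrDr mulr1 mulrCA; congr (_ + s * _).
    by rewrite -expRD; congr expR; rewrite /T; ring.
  by rewrite /a /c /E /T; field.
- move=> x; have [x1|/ltW x1] := leP x 1.
    exact: le_trans (expR_ge0 _) (expR_le x x1).
  have x0 : 0 <= x by rewrite (le_trans _ x1).
  have Es k : 0 <= s ^+ k * E / (1 + s) ^+ 2.
    apply: divr_ge0; last exact: ltW.
    by rewrite mulr_ge0// exprn_ge0// ltW.
  have ts0 : 0 <= t * s by rewrite mulr_ge0// ltW.
  have b0 : 0 <= b.
    by rewrite mulr_ge0// addr_ge0//; have := Es 1%N; rewrite expr1; lra.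
  have a0 : 0 <= a by rewrite mulr_ge0// !addr_ge0.
  by rewrite !addr_ge0// mulr_ge0// exprn_ge0.
Qed.

(** Chernoff's bound for n copies of the two-point law, minimized over t. *)
Lemma Hfun_chernoff (R : realType) (n : nat) (x v s : R) : (0 < n)%N ->
  0 < s -> v ^+ 2 = n%:R * s -> 0 < x -> x < n%:R ->
  exists2 t, 0 < t & expR (- (t * x)) * two_point_mgf s t ^+ n = Hfun n x v.
Proof.
move=> n0 s0 vs x0 xn; rewrite /Hfun (ltW xn) vs.
have N0 : (0 : R) < n%:R by rewrite ltr0n.
set N : R := n%:R in N0 vs xn *.
have Ns0 : 0 < N * s by rewrite mulr_gt0.
have xs0 : 0 < x + N * s by rewrite addr_gt0.
have nx0 : 0 < N - x by rewrite subr_gt0.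
have s10 : 0 < 1 + s by rewrite addr_gt0.
pose p := N * s / (x + N * s); pose q := N / (N - x).
have p0 : 0 < p by rewrite divr_gt0.
have q0 : 0 < q by rewrite divr_gt0.
pose t := (ln q - ln p) / (1 + s).
have NsE : N / (N + N * s) = (1 + s)^-1.
  by field; rewrite !gt_eqF// -[X in X + _]mulr1 -mulrDr mulr_gt0.
(* The minimum of exp(- t x) times the n-th power of the two-point moment
   generating function is where exp(t (1 + s)) = q / p. *)
exists t.
  rewrite divr_gt0// subr_gt0 ltr_ln ?posrE//.
  apply: (@lt_trans _ _ 1).
    by rewrite ltr_pdivrMr// mul1r ltrDr.
  by rewrite ltr_pdivlMr// mul1r ltrBlDr ltrDl.
have mE : two_point_mgf s t = expR (- (t * s)) * q.
  have -> : two_point_mgf s t =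
      expR (- (t * s)) * (1 + s * expR (t * (1 + s))) / (1 + s).
    rewrite /two_point_mgf; congr (_ / _).
    rewrite mulrDr mulr1 mulrCA; congr (_ + s * _).
    by rewrite -expRD; congr expR; ring.
  rewrite /t divfK ?gt_eqF// expRB !lnK ?posrE//.
  rewrite -mulrA; congr (_ * _); rewrite /p /q; field.
  by rewrite !gt_eqF.
rewrite mE exprMn -expRM_natr -/N -{1}(lnK (_ : q \is Num.pos)) ?posrE//.
rewrite -expRM_natr -/N -!expRD NsE.
rewrite /powR !gt_eqF// ?mulr_gt0 ?expR_gt0//.
rewrite -/p -/q -expRD expRK; congr expR.
rewrite /t; field.
by rewrite gt_eqF.
Qed.

(** * Measurability of Lipschitz functionals *)

(** Only the coordinates 0, ..., k matter, and only the last one has a constant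
that changes when innovations are integrated out. Histories are sequences
indexed by nat so that the type does not change with k. *)
Definition history_lipschitz (R : realType) (X : metricType R) (k : nat)
    (L : R) (phi : (nat -> X) -> R) : Prop :=
  forall h h', `|phi h - phi h'| <=
    \sum_(i < k) mdist (h i) (h' i) + L * mdist (h k) (h' k).

Lemma open_mdist_lt (R : realType) (X : metricType R) (x : X) (a : R) :
  open [set y | mdist x y < a].
Proof.
rewrite openE => y /= ya; apply/nbhs_ballP; exists (a - mdist x y).
  by rewrite /= subr_gt0.
rewrite ballEmdist => z /= yz.
by rewrite (le_lt_trans (metric_triangle x y z))// -ltrBrDl.
Qed.

Lemma measurable_mdist (R : realType) (X : completeMetricType R) (x : X) :
  measurable_fun setT (mdist x : borelType X -> R).
Proof.
move=> mD.
apply: (measurability _ (measurable_realfun.RGenInftyO.measurableE R)) => //.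
move=> /= _ [_ [a ->] <-]; rewrite setTI.
apply: sub_sigma_algebra.
rewrite (_ : _ @^-1` _ = [set y | mdist x y < a]); first exact: open_mdist_lt.
by apply/seteqP; split => y /=; rewrite in_itv.
Qed.

Lemma separable_dense_seq (R : realType) (X : completeMetricType R) :
  separable X ->
  exists e : nat -> X, forall x r, 0 < r -> exists j, mdist x (e j) < r.
Proof.
move=> [D /pcard_surjP[e eD] dD]; exists e => x r r0.
have [|y [/= xy /eD[j _ jy]]] :=
    dD [set y | mdist x y < r] _ (open_mdist_lt x r).
  by exists x => /=; rewrite mdistxx.
by exists j; rewrite jy.
Qed.

(** The functional is the infimum, over the sequences q from a countable dense
set, of the cones phi(q) + (weighted distance to q), which are measurable as
finite sums of distances to fixed points. Hence its sublevel sets are countable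
unions of sublevel sets of cones. In this way no Borel structure on a product of
copies of X is involved. *)
Lemma measurable_history_lipschitz (R : realType) (X : completeMetricType R)
    (d : measure_display) (T : measurableType d) (Z : nat -> T -> X) (k : nat)
    (L : R) (phi : (nat -> X) -> R) :
  separable X -> 0 <= L -> history_lipschitz k L phi ->
  (forall i, (i <= k)%N -> measurable_fun setT (Z i : T -> borelType X)) ->
  measurable_fun setT (fun w => phi (Z ^~ w)).
Proof.
move=> /separable_dense_seq[e de] L0 lphi mZ.
move=> mD.
apply: (measurability _ (measurable_realfun.RGenInftyO.measurableE R)) => //.
move=> /= _ [_ [a ->] <-]; rewrite setTI.
(* A finite sequence of naturals encodes the approximating history q; the
   default 0 of nth completes it to an infinite history. *)
pose q (s : seq nat) i := e (nth 0%N s i).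
pose g s w := phi (q s) +
  (\sum_(i < k) mdist (q s i) (Z i w) + L * mdist (q s k) (Z k w)).
have mg s : measurable_fun setT (g s).
  apply: measurable_funD => //; apply: measurable_funD.
    apply: measurable_sum => i.
    by apply: (measurableT_comp (measurable_mdist _)); apply: mZ; exact: ltnW.
  apply: measurable_funM => //.
  by apply: (measurableT_comp (measurable_mdist _)); exact: mZ.
have [dec decK] : exists dec : nat -> seq nat, cancel pickle dec.
  by exists (fun n => odflt [::] (unpickle n)) => s; rewrite pickleK.
have -> : (fun w => phi (Z ^~ w)) @^-1` `]-oo, a[%classic =
    \bigcup_n (g (dec n) @^-1` `]-oo, a[%classic).
  apply/seteqP; split => w /=; rewrite ?in_itv/=.
    (* At a point q with coordinates r-close to Z, the cone exceeds phi (Z ^~ w)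
       by at most 2 (k + L) r. *)
    move=> pa; pose r := (a - phi (Z ^~ w)) / (2 * (k%:R + L + 1)).
    have kL : 0 < k%:R + L + 1 by rewrite ltr_wpDl ?addr_ge0.
    have r0 : 0 < r by rewrite divr_gt0 ?subr_gt0 ?mulr_gt0.
    have /choice[j jr] : forall i, exists j, mdist (Z i w) (e j) < r
      by move=> i; exact: de.
    exists (pickle (mkseq j k.+1)); first by [].
    rewrite /preimage/= decK in_itv/=.
    set s := mkseq _ _.
    have qE i : (i <= k)%N -> q s i = e (j i).
      by move=> ik; rewrite /q nth_mkseq.
    have qr i : (i <= k)%N -> mdist (q s i) (Z i w) <= r.
      by move=> ik; rewrite qE// metric_sym ltW.
    rewrite /g.
    have S : \sum_(i < k) mdist (q s i) (Z i w) + L * mdist (q s k) (Z k w) <=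
        (k%:R + L) * r.
      rewrite mulrDl lerD//; last by rewrite ler_wpM2l// qr.
      rewrite mulr_natl -[X in _ *+ X]card_ord -sumr_const;
        apply: ler_sum => i _.
      by rewrite qr// ltnW.
    have := le_trans (ler_norm _) (lphi (q s) (Z ^~ w)).
    have rE : 2 * ((k%:R + L + 1) * r) = a - phi (Z ^~ w).
      by rewrite /r; field; rewrite gt_eqF.
    move: S rE r0; set A := \sum_(i < k) _ + _; set B := k%:R + L => S rE r0 pq.
    have h1 : phi (q s) <= phi (Z ^~ w) + A by rewrite -lerBlDl.
    have h2 : 2 * (B * r) < a - phi (Z ^~ w) by rewrite -rE; nra.
    lra.
  move=> [n _]; rewrite /= in_itv/= => ga.
  apply: le_lt_trans ga; rewrite /g -lerBlDl.
  rewrite (le_trans (ler_norm _))// distrC; exact: lphi.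
apply: bigcupT_measurable => n; rewrite -[X in measurable X]setTI.
exact: (mg _ measurableT _ (measurable_itv _)).
Qed.

(** * Lipschitz functions of one random variable *)

Lemma integral_cst_probability d (T : measurableType d) (R : realType)
    (nu : probability T R) (a : R) : (\int[nu]_y a%:E = a%:E)%E.
Proof.
by rewrite (integral_cst nu measurableT a%:E)/= probability_setT mule1.
Qed.

Lemma Rintegral_cst_probability d (T : measurableType d) (R : realType)
    (nu : probability T R) (a : R) : \int[nu]_y a = a.
Proof. by rewrite /Rintegral integral_cst_probability. Qed.

Lemma ae_imply d (T : measurableType d) (R : realType)
    (mu : {measure set T -> \bar R}) (A B : T -> Prop) :
  (forall x, A x -> B x) -> {ae mu, forall x, A x} -> {ae mu, forall x, B x}.
Proof. exact: filterS. Qed.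

Section mgf.
Context d (T : measurableType d) (R : realType) (nu : probability T R).

(** Integrating the majorant a + b x + c x^2: the mean vanishes, and c >= 0 lets
an upper bound on the second moment suffice. *)
Lemma mgf_le_parabola (a b c t s2 : R) (xi : T -> R) :
  0 <= c -> (forall x, 0 <= a + b * x + c * x ^+ 2) ->
  (forall x, x <= 1 -> expR (t * x) <= a + b * x + c * x ^+ 2) ->
  nu.-integrable setT (EFin \o xi) -> \int[nu]_y xi y = 0 ->
  {ae nu, forall y, xi y <= 1} ->
  (\int[nu]_y (xi y ^+ 2)%:E <= s2%:E)%E ->
  (\int[nu]_y (expR (t * xi y))%:E <= (a + c * s2)%:E)%E.
Proof.
move=> c0 q0 qexp ixi xi0 xi1 xi2.
have mxi : measurable_fun setT xi.
  by apply/measurable_EFinP; exact: measurable_int ixi.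
have ixi2 : nu.-integrable setT (fun y => (xi y ^+ 2)%:E).
  apply/integrableP; split.
    by apply/measurable_EFinP; exact: measurable_funX.
  under eq_integral do rewrite gee0_abs ?lee_fin ?sqr_ge0//.
  exact: le_lt_trans xi2 (ltry _).
have ib : nu.-integrable setT (fun y => (b * xi y)%:E)
  by exact: (integrableZl _ b ixi).
have ic : nu.-integrable setT (fun y => (c * xi y ^+ 2)%:E)
  by exact: (integrableZl _ c ixi2).
have ia : nu.-integrable setT (fun=> a%:E)
  by exact: finite_measure_integrable_cst.
have iab : nu.-integrable setT (fun y => (a + b * xi y)%:E)
  by exact: (integrableD _ ia ib).
apply: (@le_trans _ _ (\int[nu]_y (a + b * xi y + c * xi y ^+ 2)%:E)%E).
  apply: ae_ge0_le_integral => //.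
  - by apply/measurable_EFinP; apply: measurableT_comp => //;
      exact: measurable_funM.
  - by move=> y _; rewrite lee_fin.
  - by apply: measurable_int; exact: (integrableD _ iab ic).
  - by apply: filterS xi1 => y y1 _; rewrite lee_fin; exact: qexp.
under eq_integral do rewrite EFinD.
rewrite (integralD _ iab ic)//.
under eq_integral do rewrite EFinD.
rewrite (integralD _ ia ib)//.
under [X in (_ + X + _)%E]eq_integral do rewrite EFinM.
under [X in (_ + X)%E]eq_integral do rewrite EFinM.
rewrite !integralZl// integral_cst_probability.
have -> : (\int[nu]_y (xi y)%:E = 0)%E.
  by rewrite -[LHS]fineK ?integrable_fin_num// -/(Rintegral _ _ _) xi0.
rewrite mule0 adde0 EFinD leeD2l// EFinM.
by rewrite lee_wpmul2l.
Qed.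

End mgf.

Definition mean_dist (R : realType) (Y : completeMetricType R)
    (nu : probability (borelType Y) R) (C : R) (y : Y) : R :=
  \int[nu]_y' (C * mdist y y').

Section lipschitz_concentration.
Context (R : realType) (Y : completeMetricType R).
Variables (nu : probability (borelType Y) R) (C : R).
Hypothesis sepY : separable Y.
Hypothesis C0 : 0 <= C.
Hypothesis idist : forall y,
  nu.-integrable setT (fun y' => (C * mdist y y')%:E).

Let G := mean_dist nu C.

Lemma measurable_lipschitz (psi : Y -> R) (L : R) : 0 <= L ->
  (forall y y', `|psi y - psi y'| <= L * mdist y y') ->
  measurable_fun setT (psi : borelType Y -> R).
Proof.
move=> L0 lpsi.
apply: (@measurable_history_lipschitz R Y _ (borelType Y) (fun=> id) 0%N L
  (fun h => psi (h 0%N))) => // h h'.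
by rewrite big_ord0 add0r.
Qed.

Section one_function.
Variables (psi : Y -> R) (L : R).
Hypothesis L0 : 0 <= L.
Hypothesis lpsi : forall y y', `|psi y - psi y'| <= L * (C * mdist y y').

Lemma lipschitz_measurable : measurable_fun setT (psi : borelType Y -> R).
Proof.
by apply: (@measurable_lipschitz _ (L * C)) => [|y y'];
  [exact: mulr_ge0|rewrite -mulrA].
Qed.

Lemma lipschitz_integrable : nu.-integrable setT (EFin \o psi).
Proof.
have i1 := integrableZl measurableT L (idist point).
have i2 := finite_measure_integrable_cst nu `|psi point| measurableT.
have iL := integrableD measurableT i1 i2.
apply: le_integrable iL => //.
  by apply/measurable_EFinP; exact: lipschitz_measurable.
move=> y _ /=; rewrite lee_fin [leRHS]ger0_norm; last first.
  by rewrite addr_ge0// !mulr_ge0// mdist_ge0.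
rewrite -lerBlDr (le_trans (lerB_dist _ _))// distrC.
exact: lpsi.
Qed.

(** The difference is the mean over y' of psi y - psi y'. *)
Lemma lipschitz_deviation y : `|psi y - \int[nu]_y' psi y'| <= L * G y.
Proof.
have ic : nu.-integrable setT (EFin \o (fun=> psi y))
  by exact: finite_measure_integrable_cst.
have -> : psi y - \int[nu]_y' psi y' = \int[nu]_y' (psi y - psi y').
  rewrite RintegralB//; last exact: lipschitz_integrable.
  by rewrite Rintegral_cst_probability.
have iB : nu.-integrable setT (EFin \o (fun y' => psi y - psi y')).
  exact: (integrableB measurableT ic lipschitz_integrable).
rewrite (le_trans (le_normr_Rintegral _ _))//.
rewrite /G /mean_dist -RintegralZl//; last exact: idist.
apply: le_Rintegral => //.
- exact: integrable_norm.
- exact: (integrableZl _ L (idist y)).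
Qed.

End one_function.

Lemma mean_dist_ge0 y : 0 <= G y.
Proof. by apply: Rintegral_ge0 => y' _; rewrite mulr_ge0// mdist_ge0. Qed.

Lemma measurable_mean_dist : measurable_fun setT (G : borelType Y -> R).
Proof.
apply: (@measurable_lipschitz _ C) => // y y'.
rewrite /G /mean_dist -RintegralB//; [|exact: idist|exact: idist].
rewrite (le_trans (le_normr_Rintegral _ _))//.
  exact: (integrableB measurableT (idist y) (idist y')).
have -> : C * mdist y y' = \int[nu]_z (C * mdist y y').
  by rewrite Rintegral_cst_probability.
apply: le_Rintegral => //.
- apply: integrable_norm.
  exact: (integrableB measurableT (idist y) (idist y')).
- exact: finite_measure_integrable_cst.
- move=> z _; rewrite -mulrBr normrM ger0_norm// ler_wpM2l// ler_norml.
  have h1 := metric_triangle y y' z; have h2 := metric_triangle y' y z.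
  rewrite (metric_sym y' y) in h2.
  by apply/andP; split; lra.
Qed.

Variables (M V : R).
Hypothesis G_le : {ae nu, forall y, G y <= M}.
Hypothesis G_sq : (\int[nu]_y (G y ^+ 2)%:E <= V%:E)%E.

Lemma lipschitz_deviation_ae (psi : Y -> R) (L : R) : 0 <= L ->
  (forall y y', `|psi y - psi y'| <= L * (C * mdist y y')) ->
  {ae nu, forall y, `|psi y - \int[nu]_y' psi y'| <= L * M}.
Proof.
move=> L0 lpsi; apply: ae_imply G_le => y yM.
by rewrite (le_trans (lipschitz_deviation L0 lpsi y))// ler_wpM2l.
Qed.

(** The previous bounds on the deviation, normalized by m, are the hypotheses of
[mgf_le_parabola] with variance (L / m)^2 V. *)
Lemma lipschitz_mgf (a b c t m : R) (psi : Y -> R) (L : R) :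
  0 <= c -> (forall x, 0 <= a + b * x + c * x ^+ 2) ->
  (forall x, x <= 1 -> expR (t * x) <= a + b * x + c * x ^+ 2) ->
  0 < m -> L * M <= m -> 0 <= L ->
  (forall y y', `|psi y - psi y'| <= L * (C * mdist y y')) ->
  (\int[nu]_y (expR (t * ((psi y - \int[nu]_y' psi y') / m)))%:E <=
   (a + c * (L ^+ 2 * V / m ^+ 2))%:E)%E.
Proof.
move=> c0 q0 qexp m0 LM L0 lpsi.
have ipsi := lipschitz_integrable L0 lpsi.
have mpsi := lipschitz_measurable L0 lpsi.
set e := \int[nu]_y' psi y'.
have ic : nu.-integrable setT (EFin \o (fun=> e))
  by exact: finite_measure_integrable_cst.
have iB : nu.-integrable setT (EFin \o (fun y => psi y - e)).
  exact: (integrableB measurableT ipsi ic).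
apply: (@mgf_le_parabola _ _ _ _ a b) => //.
- by have := integrableZr measurableT m^-1 iB.
- rewrite RintegralZr// RintegralB// Rintegral_cst_probability.
  by rewrite subrr mul0r.
- apply: ae_imply (lipschitz_deviation_ae L0 lpsi) => y yM.
  rewrite ler_pdivrMr// mul1r (le_trans (ler_norm _))//.
  exact: le_trans yM LM.
- apply: (@le_trans _ _ (\int[nu]_y ((L / m) ^+ 2 * G y ^+ 2)%:E)%E).
    apply: ge0_le_integral => //.
    + by move=> y _; rewrite lee_fin sqr_ge0.
    + apply/measurable_EFinP; apply: measurable_funX;
        apply: measurable_funM => //.
      by apply: measurable_funB.
    + apply/measurable_EFinP; apply: measurable_funM => //.
      by apply: measurable_funX; exact: measurable_mean_dist.
    + move=> y _; rewrite lee_fin -exprMn -[leLHS]real_normK ?num_real//.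
      rewrite lerXn2r ?nnegrE//.
        by rewrite mulr_ge0 ?mean_dist_ge0// divr_ge0// ltW.
      rewrite normrM normfV (gtr0_norm m0) mulrAC ler_pM2r ?invr_gt0//.
      exact: lipschitz_deviation.
  under eq_integral do rewrite EFinM.
  rewrite ge0_integralZl//; last 2 first.
  + by move=> y _; rewrite lee_fin sqr_ge0.
  + by rewrite lee_fin sqr_ge0.
  + have -> : L ^+ 2 * V / m ^+ 2 = (L / m) ^+ 2 * V.
      by rewrite expr_div_n mulrAC.
    rewrite [leRHS]EFinM.
    by apply: lee_wpmul2l => //; rewrite lee_fin sqr_ge0.
  + by apply/measurable_EFinP; apply: measurable_funX;
      exact: measurable_mean_dist.
Qed.
End lipschitz_concentration.

(** * Integration against an independent variable *)

Section independent_pair.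
Context d d1 d2 (Omega : measurableType d) (T1 : measurableType d1)
  (T2 : measurableType d2) (R : realType) (P : probability Omega R).
Variables (W : {RV P >-> T1}) (Z : {RV P >-> T2}).
Hypothesis WZ : forall A B, measurable A -> measurable B ->
  P ((W @^-1` A) `&` (Z @^-1` B)) = (P (W @^-1` A) * P (Z @^-1` B))%E.

Let pairWZ w := (W w, Z w).

Let mpair : measurable_fun setT pairWZ.
Proof. exact: measurable_fun_pair. Qed.

HB.instance Definition _ := isMeasurableFun.Build _ _ _ _ pairWZ mpair.

Let pairRV : {RV P >-> (T1 * T2)%type} := pairWZ.

(* By independence the law of the pair is the product of the laws. *)
Let distribution_pair (E : set (T1 * T2)) : measurable E ->
  distribution P pairRV E = (distribution P W \x distribution P Z)%E E.
Proof.
move=> mE; apply/esym; exact: product_measure_unique.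
Qed.

Lemma ge0_integral_independent (f : T1 * T2 -> \bar R) :
  measurable_fun setT f -> (forall z, 0 <= f z)%E ->
  (\int[P]_w f (W w, Z w) = \int[P]_w \int[distribution P Z]_y f (W w, y))%E.
Proof.
move=> mf f0.
rewrite -(ge0_integral_distribution pairRV mf)//.
rewrite (eq_measure_integral (distribution P W \x distribution P Z)%E);
    last first.
  by move=> E mE _; exact: distribution_pair.
rewrite fubini_tonelli1// /fubini_F.
rewrite (ge0_integral_distribution W)//.
  exact: measurable_fun_fubini_tonelli_F.
by move=> x; exact: integral_ge0.
Qed.

Lemma integral_independent (f : T1 * T2 -> \bar R) :
  measurable_fun setT f -> P.-integrable setT (fun w => f (W w, Z w)) ->
  (\int[P]_w f (W w, Z w) = \int[P]_w \int[distribution P Z]_y f (W w, y))%E.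
Proof.
move=> mf intf.
rewrite -(integral_distribution (X := pairRV) mf)//.
have intp : (distribution P W \x distribution P Z)%E.-integrable setT f.
  apply/integrableP; split => //.
  move/integrableP : intf => [_].
  have mabs : measurable_fun setT (abse \o f) by exact: measurableT_comp.
  rewrite -(ge0_integral_distribution pairRV mabs); last first.
    by move=> y; exact: abse_ge0.
  rewrite (eq_measure_integral (distribution P W \x distribution P Z)%E)//.
  by move=> E mE _; exact: distribution_pair.
rewrite (eq_measure_integral (distribution P W \x distribution P Z)%E);
    last first.
  by move=> E mE _; exact: distribution_pair.
rewrite -integral12_prod_meas1// /fubini_F.
rewrite (integral_distribution (X := W))//.
  exact: (measurable_fubini_F intp).
have := integrable_fubini_F intp.
move=> /integrableP[mF Foo]; apply/integrableP; split.
  exact: (measurableT_comp mF).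
move: Foo; rewrite (ge0_integral_distribution W)//.
exact: measurableT_comp.
Qed.

End independent_pair.

(** * Independence of the past and the next innovation *)

Section history.
Context d d1 d2 (Omega : measurableType d) (X : measurableType d1)
  (Y : measurableType d2) (R : realType) (P : probability Omega R).
Variables (X1 : {RV P >-> X}) (eps : nat -> {RV P >-> Y}).

(** A pi-system generating the sigma-algebra of X_1, eps_2, ..., eps_k. It is
made of subsets of Omega, so that the space of histories is Omega itself with
a smaller sigma-algebra. *)
Definition history_cylinders (k : nat) : set (set Omega) :=
  [set E | exists A B, [/\ measurable A, forall i, measurable (B i) &
     E = X1 @^-1` A `&`
         \bigcap_(i in [set i | (2 <= i <= k)%N]) (eps i @^-1` B i)]].

Let history k := g_sigma_algebraType (history_cylinders k).

Lemma measurable_history_cylinders k : history_cylinders k `<=` measurable.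
Proof.
move=> _ [A [B [mA mB ->]]]; apply: measurableI.
  exact: measurable_funPTI.
by apply: bigcap_measurableType => i _; exact: measurable_funPTI.
Qed.

(** The identity of Omega is thus the random variable that gives the past. *)
Lemma measurable_id_history k :
  measurable_fun setT (id : Omega -> history k).
Proof.
move=> _ E mE; rewrite setTI preimage_id.
apply: (smallest_sub _ _ mE); first exact: sigma_algebra_measurable.
exact: measurable_history_cylinders.
Qed.

Lemma history_measurable_X1 k : measurable_fun setT (X1 : history k -> X).
Proof.
move=> _ A mA; rewrite setTI; apply: sub_sigma_algebra.
exists A, (fun=> setT); split => //.
by apply/seteqP; split => w //= [].
Qed.

Lemma history_measurable_eps k i : (2 <= i <= k)%N ->
  measurable_fun setT (eps i : history k -> Y).
Proof.
move=> ik _ B mB; rewrite setTI; apply: sub_sigma_algebra.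
exists setT, (fun j => if j == i then B else setT); split => //.
- by move=> j; case: ifP.
- apply/seteqP; split => w /=.
    by move=> Bw; split => // j _ /=; case: eqP => [->|].
  by move=> [_ /(_ i ik)] /=; rewrite eqxx.
Qed.

Lemma setI_closed_history_cylinders k : setI_closed (history_cylinders k).
Proof.
move=> _ _ [A [B [mA mB ->]]] [A' [B' [mA' mB' ->]]].
exists (A `&` A'), (fun i => B i `&` B' i); split.
- exact: measurableI.
- by move=> i; exact: measurableI.
- apply/seteqP; split => w /=.
    by move=> [[? h] [? h']]; split => // i ik /=; split; [exact: h|exact: h'].
  by move=> [[? ?] h]; split; split => // i ik; have [] := h i ik.
Qed.

Hypothesis eps_indep : mutually_independent [set i | (1 <= i)%N] eps.
Hypothesis X1_indep : independent_of_family X1 [set i | (2 <= i)%N] eps.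

Lemma probability_cylinder k A (B : nat -> set Y) : measurable A ->
  (forall i, measurable (B i)) ->
  P (X1 @^-1` A `&`
     \bigcap_(i in [set i | (2 <= i <= k)%N]) (eps i @^-1` B i)) =
  (P (X1 @^-1` A) *
   \prod_(i <- [fset i in iota 2 k.-1]%fset) P (eps i @^-1` B i))%E.
Proof.
move=> mA mB; pose J := [fset i in iota 2 k.-1]%fset.
have JE : [set` J] = [set i | (2 <= i <= k)%N].
  apply/seteqP; split => i /=; rewrite !inE mem_iota.
    by case: k {J} => [|[|k]] //=; lia.
  by case: k {J} => [|[|k]] //=; lia.
rewrite X1_indep//.
  by rewrite -JE eps_indep// JE => i /= /andP[+ _]; exact: ltnW.
pose T := g_sigma_algebraType (\bigcup_(i in [set i | (2 <= i)%N])
  preimage_set_system setT (eps i : Omega -> Y) measurable).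
apply: (@bigcap_measurableType _ T) => i /= /andP[i2 _].
apply: sub_sigma_algebra; exists i => //; exists (B i) => //.
by rewrite setTI.
Qed.

(** Both sides are finite measures in E that agree on the cylinders, since
intersecting a cylinder of order k with an event on eps_(k+1) gives a cylinder
of order k + 1. Hence they agree on the generated sigma-algebra. *)
Lemma history_independent k (E : set Omega) (B : set Y) : (1 <= k)%N ->
  <<s history_cylinders k >> E -> measurable B ->
  P (E `&` eps k.+1 @^-1` B) = (P E * P (eps k.+1 @^-1` B))%E.
Proof.
move=> k1 hE mB.
have mepsB : measurable (eps k.+1 @^-1` B) by exact: measurable_funPTI.
have r0 : 0 <= fine (P (eps k.+1 @^-1` B)) by exact: fine_ge0.
pose m1 : {measure set Omega -> \bar R} := mrestr P mepsB.
pose m2 : {measure set Omega -> \bar R} := mscale (NngNum r0) P.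
have rE : (fine (P (eps k.+1 @^-1` B)))%:E = P (eps k.+1 @^-1` B).
  by rewrite fineK// fin_num_measure.
suff : m1 E = m2 E.
  by rewrite /m1/= /mrestr => ->; rewrite /m2/= /mscale/= rE muleC.
apply: (g_sigma_algebra_measure_unique (history_cylinders k) _ (fun=> setT)) hE.
- exact: measurable_history_cylinders.
- move=> _; exists setT, (fun=> setT); split => //.
  by apply/seteqP; split => w.
- by apply/seteqP; split => w //= _; exists 0%N.
- exact: setI_closed_history_cylinders.
- move=> _ [A [C [mA mC ->]]].
  rewrite /m1/= /mrestr /m2/= /mscale/= rE.
  (* The condition on eps_(k+1) becomes the last factor of a longer cylinder. *)
  pose D i := if i == k.+1 then B else C i.
  have -> : X1 @^-1` A `&`
        \bigcap_(i in [set i | (2 <= i <= k)%N]) eps i @^-1` C i `&`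
        eps k.+1 @^-1` B =
      X1 @^-1` A `&`
        \bigcap_(i in [set i | (2 <= i <= k.+1)%N]) eps i @^-1` D i.
    rewrite -setIA; congr (_ `&` _); apply/seteqP; split => w /=.
      move=> [h Bw] i /= /andP[i2 ik]; rewrite /D; case: eqP => [->//|/eqP ik1].
      by apply: h => /=; rewrite i2 -ltnS ltn_neqAle ik1.
    move=> h; split.
      move=> i /= /andP[i2 ik]; have := h i;
        rewrite /= i2 (leqW ik) => /(_ isT).
      by rewrite /D ltn_eqF.
    by have := h k.+1; rewrite /= ltnS k1 leqnn /D eqxx; exact.
  have mD i : measurable (D i) by rewrite /D; case: ifP.
  rewrite !probability_cylinder// muleCA; congr (_ * _)%E.
  have -> : [fset i in iota 2 k.+1.-1]%fset =
      (k.+1 |` [fset i in iota 2 k.-1])%fset.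
    apply/fsetP => i; rewrite !inE !mem_iota; apply/idP/idP; lia.
  rewrite big_fsetU1/=; last by rewrite !inE mem_iota; apply/negP; lia.
  rewrite /D eqxx; congr (_ * _)%E.
  apply: eq_fbigr => i /=; rewrite !inE mem_iota => ik _.
  by rewrite ltn_eqF//; lia.
- move=> _; rewrite /m1/= /mrestr.
  rewrite (le_lt_trans (probability_le1 _ _))// ?ltry//.
  exact: measurableI.
Qed.

End history.

(** * One martingale step *)

Lemma ae_bounded_integrable d (T : measurableType d) (R : realType)
    (P : probability T R) (g : T -> R) (M : R) :
  measurable_fun setT g -> {ae P, forall w, `|g w| <= M} ->
  P.-integrable setT (EFin \o g).
Proof.
move=> mg gM; apply/integrableP; split; first exact/measurable_EFinP.
apply: (@le_lt_trans _ _ (`|M|%:E * P setT)%E).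
  apply: integral_le_bound => //.
  - exact/measurable_EFinP.
  - apply: ae_imply gM => w wM _.
    by rewrite /= lee_fin (le_trans wM)// ler_norm.
by rewrite probability_setT mule1 ltry.
Qed.

Lemma ae_distribution d d' (T : measurableType d) (T' : measurableType d')
    (R : realType) (P : probability T R) (Z : {RV P >-> T'}) (A : set T') :
  {ae distribution P Z, forall y, A y} -> {ae P, forall w, A (Z w)}.
Proof.
move=> [N [mN N0 AN]]; exists (Z @^-1` N); split => //.
  exact: measurable_funPTI.
by move=> w /= nA; apply: AN.
Qed.

(** The moment assumptions on G_X1 and G_eps, stated for the law with the real
valued mean distance; integrability makes that distance the extended real
one. *)
Definition controlled_law (R : realType) (Y : completeMetricType R)
    (nu : probability (borelType Y) R) (C M V : R) : Prop :=
  [/\ forall y, nu.-integrable setT (fun y' => (C * mdist y y')%:E),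
      {ae nu, forall y, mean_dist nu C y <= M} &
      (\int[nu]_y (mean_dist nu C y ^+ 2)%:E <= V%:E)%E].

Section one_step.
Context d d1 (Omega : measurableType d) (T : measurableType d1) (R : realType)
  (P : probability Omega R) (Y : completeMetricType R).
Variables (W : {RV P >-> T}) (Z : {RV P >-> borelType Y}).
Hypothesis WZ : forall A B, measurable A -> measurable B ->
  P ((W @^-1` A) `&` (Z @^-1` B)) = (P (W @^-1` A) * P (Z @^-1` B))%E.
Let nu : probability (borelType Y) R := distribution P Z.
Variables (C M V m L : R).
Hypothesis sepY : separable Y.
Hypothesis C0 : 0 <= C.
Hypothesis cnu : controlled_law nu C M V.
Hypothesis L0 : 0 <= L.
Hypothesis m0 : 0 < m.
Hypothesis LM : L * M <= m.
Variable Phi : T -> Y -> R.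
Hypothesis mPhi : measurable_fun setT
  (fun z : T * borelType Y => Phi z.1 z.2).
Hypothesis lPhi : forall x y y', `|Phi x y - Phi x y'| <= L * (C * mdist y y').
Let phi x := \int[nu]_y Phi x y.
Hypothesis mphi : measurable_fun setT phi.
Hypothesis iphi : P.-integrable setT (fun w => (phi (W w))%:E).

Let D (z : T * borelType Y) : R := Phi z.1 z.2 - phi z.1.

Let mD : measurable_fun setT D.
Proof. by apply: measurable_funB => //; exact: (measurableT_comp mphi). Qed.

Let mWZ : measurable_fun setT (fun w => (W w, Z w)).
Proof. exact: measurable_fun_pair. Qed.

(** The martingale difference of one step is Phi (W w) (Z w) - phi (W w), where
W is the past, Z the innovation, and phi the mean of Phi over the innovation. *)
Lemma step_ae : {ae P, forall w, `|Phi (W w) (Z w) - phi (W w)| <= m}.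
Proof.
have [idist G_le _] := cnu.
apply: ae_imply (ae_distribution G_le) => w wM.
apply: le_trans (lipschitz_deviation sepY C0 idist L0 (lPhi (W w)) (Z w)) _.
by apply: le_trans LM; rewrite ler_wpM2l.
Qed.

Let iD : P.-integrable setT (EFin \o (fun w => D (W w, Z w))).
Proof.
apply: ae_bounded_integrable step_ae.
exact: (measurableT_comp mD mWZ).
Qed.

Lemma step_integrable : P.-integrable setT (fun w => (Phi (W w) (Z w))%:E).
Proof.
have := integrableD measurableT iphi iD.
by apply: eq_integrable => // w _ /=; rewrite -EFinD addrC subrK.
Qed.

Let integral_D x : \int[nu]_y D (x, y) = 0.
Proof.
have [idist _ _] := cnu.
rewrite /D /= RintegralB//; last 2 first.
- exact: (lipschitz_integrable sepY C0 idist L0 (lPhi x)).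
- exact: finite_measure_integrable_cst.
by rewrite Rintegral_cst_probability subrr.
Qed.

Lemma step_mean : \int[P]_w Phi (W w) (Z w) = \int[P]_w phi (W w).
Proof.
have [idist _ _] := cnu.
apply/eqP; rewrite -subr_eq0 -RintegralB//; last exact: step_integrable.
rewrite /Rintegral.
have -> : (\int[P]_w (Phi (W w) (Z w) - phi (W w))%:E)%E =
    (\int[P]_w ((EFin \o D) (W w, Z w)))%E by [].
rewrite integral_independent//.
- rewrite [X in fine X](_ : _ = 0%E)//.
  rewrite -[RHS](integral0 P setT); apply: eq_integral => w _.
  rewrite -[RHS]/(0%:E) -(integral_D (W w)) /Rintegral fineK//.
  apply: integrable_fin_num => //.
  exact: (integrableB measurableT
    (lipschitz_integrable sepY C0 idist L0 (lPhi (W w)))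
    (finite_measure_integrable_cst nu (phi (W w)) measurableT)).
- exact/measurable_EFinP.
Qed.

Variables (a b c t e : R).
Hypothesis c0 : 0 <= c.
Hypothesis q0 : forall x, 0 <= a + b * x + c * x ^+ 2.
Hypothesis qexp : forall x, x <= 1 -> expR (t * x) <= a + b * x + c * x ^+ 2.

Let parabola_ge0 : 0 <= a + c * (L ^+ 2 * V / m ^+ 2).
Proof.
have [idist G_le G_sq] := cnu; rewrite -lee_fin.
apply: le_trans (lipschitz_mgf sepY C0 idist G_le G_sq c0 q0 qexp m0 LM L0
  (lPhi point)).
by apply: integral_ge0 => y _; rewrite lee_fin expR_ge0.
Qed.

(** For a fixed past, exp(t (Phi - e) / m) is the product of a factor depending
on the past only and of exp(t (Phi - phi) / m); the mean of the latter over the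
innovation has a bound that is uniform in the past. *)
Lemma step_mgf :
  (\int[P]_w (expR (t * ((Phi (W w) (Z w) - e) / m)))%:E <=
   (a + c * (L ^+ 2 * V / m ^+ 2))%:E *
   \int[P]_w (expR (t * ((phi (W w) - e) / m)))%:E)%E.
Proof.
have [idist G_le G_sq] := cnu.
pose g (z : T * borelType Y) := expR (t * ((Phi z.1 z.2 - e) / m)).
have mg : measurable_fun setT (EFin \o g).
  apply/measurable_EFinP; apply: (measurableT_comp (@measurable_expR R)).
  apply: measurable_funM => //; apply: measurable_funM => //.
  exact: measurable_funB.
have g0 z : (0 <= (EFin \o g) z)%E by rewrite lee_fin expR_ge0.
rewrite (ge0_integral_independent WZ mg g0).
have mphie : measurable_fun setT
    (fun w => (expR (t * ((phi (W w) - e) / m)))%:E).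
  apply/measurable_EFinP; apply: (measurableT_comp (@measurable_expR R)).
  apply: measurable_funM => //; apply: measurable_funM => //.
  by apply: measurable_funB => //; exact: (measurableT_comp mphi).
have mgf w : (\int[nu]_y (EFin \o g) (W w, y) <=
    (a + c * (L ^+ 2 * V / m ^+ 2))%:E *
    (expR (t * ((phi (W w) - e) / m)))%:E)%E.
  have := lipschitz_mgf sepY C0 idist G_le G_sq c0 q0 qexp m0 LM L0
    (lPhi (W w)).
  rewrite -/(phi (W w)) => h.
  rewrite [leLHS](_ : _ = (expR (t * ((phi (W w) - e) / m)))%:E *
    \int[nu]_y (expR (t * ((Phi (W w) y - phi (W w)) / m)))%:E)%E.
    by rewrite muleC; apply: lee_wpmul2r => //; rewrite lee_fin expR_ge0.
  rewrite -ge0_integralZl//; last first.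
    apply/measurable_EFinP; apply: (measurableT_comp (@measurable_expR R)).
    apply: measurable_funM => //; apply: measurable_funM => //.
    apply: measurable_funB => //.
    exact: (lipschitz_measurable sepY C0 L0 (lPhi (W w))).
  apply: eq_integral => y _; rewrite /= /g -EFinM -expRD; congr (expR _)%:E.
  by rewrite /=; ring.
apply: (@le_trans _ _ (\int[P]_w ((a + c * (L ^+ 2 * V / m ^+ 2))%:E *
    (expR (t * ((phi (W w) - e) / m)))%:E))%E).
  apply: ge0_le_integral => //.
  - by move=> w _; exact: integral_ge0.
  - apply: (@measurableT_comp _ _ _ _ _ _
      (fun x => \int[distribution P Z]_y (EFin \o g) (x, y))%E) => //.
    exact: (measurable_fun_fubini_tonelli_F (EFin \o g)).
  - by apply: emeasurable_funM.
by rewrite ge0_integralZl ?lee_fin ?parabola_ge0.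
Qed.

(** Passing from phi (W w) to Phi (W w) (Z w) keeps the mean, adds at most m to
the range, and multiplies the bound on the moment generating function by the
bound for one difference. *)
Lemma step_concentration (k : nat) (B : R) :
  e = \int[P]_w phi (W w) ->
  {ae P, forall w, `|phi (W w) - e| <= k%:R * m} ->
  (\int[P]_w (expR (t * ((phi (W w) - e) / m)))%:E <= B%:E)%E ->
  [/\ P.-integrable setT (fun w => (Phi (W w) (Z w))%:E),
      e = \int[P]_w Phi (W w) (Z w),
      {ae P, forall w, `|Phi (W w) (Z w) - e| <= k.+1%:R * m} &
      (\int[P]_w (expR (t * ((Phi (W w) (Z w) - e) / m)))%:E <=
       ((a + c * (L ^+ 2 * V / m ^+ 2)) * B)%:E)%E].
Proof.
move=> eE phi_ae phi_mgf; split.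
- exact: step_integrable.
- by rewrite step_mean.
- have h w : `|phi (W w) - e| <= k%:R * m ->
      `|Phi (W w) (Z w) - phi (W w)| <= m ->
      `|Phi (W w) (Z w) - e| <= k.+1%:R * m.
    move=> h1 h2; rewrite -natr1 mulrDl mul1r.
    have -> : Phi (W w) (Z w) - e =
        (phi (W w) - e) + (Phi (W w) (Z w) - phi (W w)).
      by ring.
    by rewrite (le_trans (ler_normD _ _))// lerD.
  by apply: filterS2 phi_ae step_ae.
- by apply: le_trans step_mgf _; rewrite EFinM; apply: lee_wpmul2l.
Qed.

End one_step.

(** * Laws with controlled mean distances; geometric sums *)

Lemma ae_distribution_inv d d' (T : measurableType d) (T' : measurableType d')
    (R : realType) (P : probability T R) (Z : {RV P >-> T'}) (A : set T') :
  measurable A -> {ae P, forall w, A (Z w)} ->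
  {ae distribution P Z, forall y, A y}.
Proof.
move=> mA [N [mN N0 AN]]; exists (~` A); split => //; first exact: measurableC.
apply/eqP; rewrite eq_le measure_ge0 andbT -N0.
apply: (@le_measure _ _ _ P); rewrite ?inE//.
by apply: measurable_funPTI; exact: measurableC.
Qed.

Lemma controlled_law_eq (R : realType) (Y : completeMetricType R)
    (nu nu' : probability (borelType Y) R) (C M V : R) :
  (forall A : set (borelType Y), measurable A -> nu A = nu' A) ->
  controlled_law nu C M V -> controlled_law nu' C M V.
Proof.
move=> nuE [idist G_le G_sq].
have GE : mean_dist nu C = mean_dist nu' C.
  apply/funext => y; rewrite /mean_dist /Rintegral; congr fine.
  by apply: eq_measure_integral => A mA _; exact: nuE.
split.
- move=> y; have /integrableP[mf foo] := idist y; apply/integrableP;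
    split => //.
  rewrite (eq_measure_integral nu)// => A mA _; exact/esym/nuE.
- rewrite -GE; have [N [mN N0 AN]] := G_le; exists N; split => //.
  by rewrite -nuE.
- rewrite -GE (eq_measure_integral nu)// => A mA _; exact/esym/nuE.
Qed.

Lemma ae_exists d (T : measurableType d) (R : realType) (P : probability T R)
    (A : set T) : {ae P, forall w, A w} -> exists w, A w.
Proof.
move=> [N [mN N0 AN]]; apply: contrapT => nA.
have : P setT = 0%E.
  apply/eqP; rewrite eq_le measure_ge0 andbT -N0; apply: le_measure;
    rewrite ?inE//.
  by move=> w _; apply: AN => Aw; apply: nA; exists w.
by rewrite probability_setT => /eqP; rewrite onee_eq0.
Qed.

(** Boundedness of the mean distance at a single point, provided by the almost
sure bound, makes it finite everywhere by the triangle inequality. *)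
Lemma controlled_law_distribution d (Omega : measurableType d) (R : realType)
    (P : probability Omega R) (Y : completeMetricType R)
    (Z : {RV P >-> borelType Y}) (C M V : R) :
  separable Y -> 0 <= C ->
  {ae P, forall w, (mean_distance C Z (Z w) <= M%:E)%E} ->
  (\int[P]_w (mean_distance C Z (Z w)) ^+ 2 <= V%:E)%E ->
  controlled_law (distribution P Z) C M V.
Proof.
move=> sepY C0 GM GV; set nu : probability (borelType Y) R := distribution P Z.
have mC y : measurable_fun setT (fun y' : borelType Y => (C * mdist y y')%:E).
  by apply/measurable_EFinP; apply: measurable_funM => //;
    exact: measurable_mdist.
have Cd0 y y' : 0 <= C * mdist y y' by rewrite mulr_ge0// mdist_ge0.
have idist y : nu.-integrable setT (fun y' => (C * mdist y y')%:E).
  have [w0 w0M] := ae_exists GM.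
  have i0 : nu.-integrable setT (fun y' => (C * mdist (Z w0) y')%:E).
    apply/integrableP; split => //.
    under eq_integral do rewrite gee0_abs ?lee_fin//.
    exact: le_lt_trans w0M (ltry _).
  have i1 := finite_measure_integrable_cst nu (C * mdist y (Z w0)) measurableT.
  apply: le_integrable (integrableD measurableT i1 i0) => // y' _ /=.
  rewrite lee_fin !ger0_norm ?addr_ge0// -mulrDr ler_wpM2l//.
  exact: metric_triangle.
have GE y : mean_distance C Z y = (mean_dist nu C y)%:E.
  by rewrite /mean_dist /Rintegral fineK//; exact: integrable_fin_num.
have mG : measurable_fun setT (mean_dist nu C : borelType Y -> R).
  exact: measurable_mean_dist.
split => //.
- apply: ae_distribution_inv.
    rewrite [X in measurable X](_ : _ = mean_dist nu C @^-1` `]-oo, M]%classic).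
      by rewrite -[X in measurable X]setTI; exact: mG.
    by apply/seteqP; split => y /=; rewrite in_itv.
  by apply: ae_imply GM => w; rewrite GE lee_fin.
- rewrite (ge0_integral_distribution Z)//.
  + apply: le_trans GV; rewrite le_eqVlt; apply/orP; left; apply/eqP.
    by apply: eq_integral => w _; rewrite GE /= EFin_expe.
  + by apply/measurable_EFinP; apply: measurable_funX.
  + by move=> y; rewrite lee_fin sqr_ge0.
Qed.

Section geometric_sum.
Context (R : realType) (rho : R).
Hypothesis rho0 : 0 <= rho.

Lemma geometric_sum0 : geometric_sum rho 0 = 1.
Proof. by rewrite /geometric_sum big_nat1 expr0. Qed.

(** This is the recursion of the Lipschitz constants in [average_lipschitz]. *)
Lemma geometric_sumS k :
  geometric_sum rho k.+1 = 1 + rho * geometric_sum rho k.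
Proof.
rewrite /geometric_sum big_nat_recl// expr0 big_distrr/=; congr (_ + _).
by apply: eq_bigr => i _; rewrite exprS.
Qed.

Lemma geometric_sum_gt0 k : 0 < geometric_sum rho k.
Proof.
elim: k => [|k ih]; first by rewrite geometric_sum0.
by rewrite geometric_sumS ltr_wpDr// mulr_ge0// ltW.
Qed.

Lemma geometric_sum_le j k : (j <= k)%N ->
  geometric_sum rho j <= geometric_sum rho k.
Proof.
move=> jk; rewrite /geometric_sum (@big_cat_nat _ _ _ j.+1 0 k.+1)//=.
by rewrite lerDl sumr_ge0// => i _; rewrite exprn_ge0.
Qed.

End geometric_sum.

(** * Induction along the chain *)

Definition update (T : Type) (h : nat -> T) (k : nat) (x : T) : nat -> T :=
  fun i => if i == k then x else h i.

Section chain.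
Context (R : realType) (X Y : completeMetricType R) (d : measure_display)
  (Omega : measurableType d) (P : probability Omega R).
Variables (F : borelType X * borelType Y -> borelType X) (rho C : R).
Hypothesis sepX : separable X.
Hypothesis sepY : separable Y.
Hypothesis mF : measurable_fun setT F.
Hypothesis rho_ge0 : 0 <= rho.
Hypothesis C_ge0 : 0 <= C.
Hypothesis F_lip : forall (x : X) (y y' : Y),
  mdist (F (x, y) : X) (F (x, y') : X) <= C * mdist y y'.

Lemma noise_mdist_lipschitz (x x' : X) (y y' : Y) :
  `|mdist (F (x, y) : X) (F (x', y) : X) -
    mdist (F (x, y') : X) (F (x', y') : X)| <= 2 * (C * mdist y y').
Proof.
have h1 := F_lip x y y'; have h2 := F_lip x' y y'.
have := metric_triangle (F (x, y) : X) (F (x, y')) (F (x', y)).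
have := metric_triangle (F (x, y') : X) (F (x', y')) (F (x', y)).
have := metric_triangle (F (x, y') : X) (F (x, y)) (F (x', y')).
have := metric_triangle (F (x, y) : X) (F (x', y)) (F (x', y')).
rewrite (metric_sym (F (x', y') : X) (F (x', y))).
rewrite (metric_sym (F (x, y') : X) (F (x, y))).
move=> ? ? ? ?; rewrite ler_norml; apply/andP; split; lra.
Qed.

(* The value of phi on the history h prolonged by the state that follows h k
   when the innovation is y. *)
Let extend (phi : (nat -> X) -> R) k (h : nat -> X) (y : Y) : R :=
  phi (update h k.+1 (F (h k, y))).

Lemma extend_lipschitz phi k (L : R) (h : nat -> X) (y y' : Y) : 0 <= L ->
  history_lipschitz k.+1 L phi ->
  `|extend phi k h y - extend phi k h y'| <= L * (C * mdist y y').
Proof.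
move=> L0 lphi; apply: le_trans (lphi _ _) _.
rewrite big1 ?add0r => [|i _]; last by rewrite /update ltn_eqF// mdistxx.
by rewrite /update eqxx ler_wpM2l.
Qed.

(** Two histories prolonged by the same innovation differ by their previous
distances, plus L times a distance whose mean is at most rho times that of the
last states; the coordinate k thus collects 1 + rho L. *)
Lemma average_lipschitz (nu : probability (borelType Y) R) phi k (L : R) :
  (forall y, nu.-integrable setT (fun y' => (C * mdist y y')%:E)) ->
  (forall x x' : X, \int[nu]_y mdist (F (x, y) : X) (F (x', y) : X) <=
     rho * mdist x x') ->
  0 <= L -> history_lipschitz k.+1 L phi ->
  history_lipschitz k (1 + rho * L) (fun h => \int[nu]_y extend phi k h y).
Proof.
move=> idist contr L0 lphi h h'.
have iextend g : nu.-integrable setT (EFin \o extend phi k g).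
  apply: (lipschitz_integrable sepY C_ge0 idist L0) => y y'.
  exact: extend_lipschitz.
have idF (x x' : X) : nu.-integrable setT
    (EFin \o (fun y => mdist (F (x, y) : X) (F (x', y) : X))).
  apply: (lipschitz_integrable sepY C_ge0 idist (_ : 0 <= 2)) => // y y'.
  exact: noise_mdist_lipschitz.
set S := \sum_(i < k) mdist (h i) (h' i).
have iS := finite_measure_integrable_cst nu
  (S + mdist (h k) (h' k)) measurableT.
have iLF := integrableZl measurableT L (idF (h k) (h' k)).
rewrite -RintegralB//; try exact: iextend.
apply: le_trans (le_normr_Rintegral _ _) _ => //.
  exact: (integrableB measurableT (iextend h) (iextend h')).
apply: (@le_trans _ _ (\int[nu]_y (S + mdist (h k) (h' k) +
    L * mdist (F (h k, y) : X) (F (h' k, y) : X)))).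
  apply: le_Rintegral => //.
  - apply: integrable_norm.
    exact: (integrableB measurableT (iextend h) (iextend h')).
  - exact: (integrableD measurableT iS iLF).
  - move=> y _; apply: le_trans (lphi _ _) _.
    rewrite /update !eqxx lerD2r big_ord_recr/= (ltn_eqF (ltnSn k)) lerD2r.
    apply: ler_sum => i _; rewrite ltn_eqF//.
    by rewrite ltnS ltnW.
rewrite (RintegralD measurableT iS iLF).
rewrite Rintegral_cst_probability (RintegralZl _ measurableT (idF _ _)).
rewrite mulrDl mul1r addrA lerD2l -mulrA [leRHS]mulrCA.
by rewrite ler_wpM2l.
Qed.

Variables (eps : nat -> {RV P >-> borelType Y})
  (Xs : nat -> {RV P >-> borelType X}).
Hypothesis eps_indep : mutually_independent [set i | (1 <= i)%N] eps.
Hypothesis X1_indep : independent_of_family (Xs 1%N) [set i | (2 <= i)%N] eps.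
Hypothesis Xs_rec : forall k, (2 <= k)%N ->
    forall w, Xs k w = F (Xs k.-1 w, eps k w).

Let history k := g_sigma_algebraType (history_cylinders (Xs 1%N) eps k).

(** Each state is a function of X_1 and of the innovations so far. *)
Lemma history_measurable_chain k i : (1 <= i <= k)%N ->
  measurable_fun setT (Xs i : history k -> borelType X).
Proof.
elim: i => // -[_|i ih] /=; first by move=> _; exact: history_measurable_X1.
move=> ik; rewrite (_ : (Xs i.+2 : _ -> _) =
    F \o (fun w => (Xs i.+1 w, eps i.+2 w))).
  apply: (measurableT_comp mF); apply: measurable_fun_pair.
    by apply: ih => /=; exact: ltnW.
  exact: history_measurable_eps.
by apply/funext => w /=; rewrite Xs_rec.
Qed.

Variables (M V1 V2 : R).
Hypothesis M_gt0 : 0 < M.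
Hypothesis ctlX : controlled_law (distribution P (Xs 1%N)) 1 M V1.
Hypothesis ctlY : forall k, (1 <= k)%N ->
  controlled_law (distribution P (eps k)) C M V2.
Hypothesis contr : forall k, (1 <= k)%N -> forall x x' : X,
  \int[distribution P (eps k)]_y mdist (F (x, y) : X) (F (x', y) : X) <=
  rho * mdist x x'.

Let K := geometric_sum rho.
Let trajectory (w : Omega) : nat -> X := fun i => Xs i.+1 w.

Variables (N : nat) (a b c t : R).
Hypothesis c0 : 0 <= c.
Hypothesis q0 : forall x, 0 <= a + b * x + c * x ^+ 2.
Hypothesis qexp : forall x, x <= 1 -> expR (t * x) <= a + b * x + c * x ^+ 2.

Let m := M * K N.

(** Induction on the number k + 1 of states, for all functionals phi at once:
integrating out the last innovation gives a functional with one state less, the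
same mean e, and the constant K_(j+1). The sum j + k is invariant, and it gives
the normalization m, which bounds every difference since the K_j increase. *)
Lemma chain_concentration k j phi : (j + k)%N = N ->
  history_lipschitz k (K j) phi ->
  let e := \int[P]_w phi (trajectory w) in
  [/\ P.-integrable setT (fun w => (phi (trajectory w))%:E),
      {ae P, forall w, `|phi (trajectory w) - e| <= k.+1%:R * m} &
      (\int[P]_w (expR (t * ((phi (trajectory w) - e) / m)))%:E <=
       ((a + c * (K N ^+ 2 * V1 / m ^+ 2)) *
        \prod_(i < k) (a + c * (K (j + i)%N ^+ 2 * V2 / m ^+ 2)))%:E)%E].
Proof.
have Kgt0 i : 0 < K i by exact: geometric_sum_gt0.
have m0 : 0 < m by rewrite mulr_gt0.
elim: k j phi => [|k IH] j phi jk lphi e.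
- rewrite addn0 in jk; rewrite jk in lphi.
  (* X_1 is treated as an innovation that follows a constant past. *)
  pose Phi (z : borelType Y) (x : X) := phi (fun=> x).
  pose W : {RV P >-> borelType Y} := cst point.
  have phiE w : phi (trajectory w) = Phi (W w) (Xs 1%N w).
    apply/eqP; rewrite -subr_eq0 -normr_le0; apply: le_trans (lphi _ _) _.
    by rewrite big_ord0 add0r mdistxx mulr0.
  have lPhi z x x' : `|Phi z x - Phi z x'| <= K N * (1 * mdist x x').
    by apply: le_trans (lphi _ _) _; rewrite big_ord0 add0r mul1r.
  have mPhi : measurable_fun setT
      (fun z : borelType Y * borelType X => Phi z.1 z.2).
    apply: (@measurable_history_lipschitz _ _ _ _
      (fun _ (z : borelType Y * borelType X) => z.2 : X)
      _ _ _ sepX (ltW (Kgt0 N)) lphi).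
    by move=> i _; exact: measurable_snd.
  have WX A B : measurable A -> measurable B ->
      P ((W @^-1` A) `&` (Xs 1%N @^-1` B)) =
      (P (W @^-1` A) * P (Xs 1%N @^-1` B))%E.
    move=> mA mB; have [Ap|Ap] := pselect (A point).
      rewrite (_ : W @^-1` A = setT) ?setTI ?probability_setT ?mul1e//.
      by apply/seteqP; split.
    rewrite (_ : W @^-1` A = set0) ?set0I ?measure0 ?mul0e//.
    by apply/seteqP; split.
  pose e0 := \int[distribution P (Xs 1%N)]_x phi (fun=> x).
  have KM : K N * M <= m by rewrite mulrC.
  have ie0 : P.-integrable setT (fun=> e0%:E)
    by exact: finite_measure_integrable_cst.
  have e0E : e0 = \int[P]_w e0 by rewrite Rintegral_cst_probability.
  have e0_ae : {ae P, forall w, `|e0 - e0| <= 0%:R * m}.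
    by apply: aeW => w; rewrite subrr normr0 mul0r.
  have e0_mgf : (\int[P]_w (expR (t * ((e0 - e0) / m)))%:E <= 1%:E)%E.
    by rewrite subrr mul0r mulr0 expR0 integral_cst_probability.
  have := @step_concentration _ _ _ _ _ _ _ W (Xs 1%N) WX 1 M V1 m (K N) sepX
    ler01 ctlX (ltW (Kgt0 N)) m0 KM Phi mPhi lPhi (measurable_cst e0) ie0
    a b c t e0 c0 q0 qexp 0%N 1 e0E e0_ae e0_mgf.
  rewrite (_ : \int[P]_w Phi (W w) (Xs 1%N w) = e); last first.
    by congr Rintegral; apply/funext => w; rewrite phiE.
  case=> iphi -> phi_ae phi_mgf; split => //.
  + by apply: eq_integrable iphi => // w _ /=; rewrite phiE.
  + by apply: ae_imply phi_ae => w; rewrite phiE.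
  + rewrite big_ord0 mulr1.
    by under eq_integral do rewrite phiE; rewrite mulr1 in phi_mgf.
- (* The coordinate k + 1 of the trajectory is the state of index k + 2. *)
  pose nu : probability (borelType Y) R := distribution P (eps k.+2).
  have [idist _ _] : controlled_law nu C M V2 by exact: ctlY.
  have L0 : 0 <= K j by exact: ltW.
  pose phi' (h : nat -> X) := \int[nu]_y extend phi k h y.
  have lphi' : history_lipschitz k (K j.+1) phi'.
    rewrite /K geometric_sumS; apply: average_lipschitz => //.
    exact: contr.
  have [iphi' phi'_ae phi'_mgf] := IH j.+1 phi' (etrans (addSnnS _ _) jk) lphi'.
  pose T := history k.+1.
  pose W : {RV P >-> T} := HB.pack (id : Omega -> T)
    (isMeasurableFun.Build _ _ _ _ (id : Omega -> T)
      (@measurable_id_history _ _ _ _ _ _ _ P (Xs 1%N) eps k.+1)).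
  pose Phi (w : T) (y : Y) := extend phi k (trajectory w) y.
  have phiE w : phi (trajectory w) = Phi (W w) (eps k.+2 w).
    congr phi; apply/funext => i; rewrite /update /trajectory;
      case: eqP => // ->.
    by rewrite Xs_rec.
  have lPhi z y y' : `|Phi z y - Phi z y'| <= K j * (C * mdist y y').
    exact: extend_lipschitz.
  have mtraj i : (i <= k)%N ->
      measurable_fun setT (fun w : T => trajectory w i : borelType X).
    by move=> ik; exact: (@history_measurable_chain k.+1 i.+1).
  have mPhi : measurable_fun setT (fun z : T * borelType Y => Phi z.1 z.2).
    apply: (@measurable_history_lipschitz _ _ _ _
      (fun i (z : T * borelType Y) =>
        update (trajectory z.1) k.+1 (F (trajectory z.1 k, z.2)) i)
      _ _ _ sepX L0 lphi).
    move=> i ik; rewrite /update; case: eqP => [_|/eqP ik1].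
      apply: (measurableT_comp mF); apply: measurable_fun_pair => //.
      exact: (measurableT_comp (mtraj k (leqnn k))).
    apply: (measurableT_comp (mtraj i _)) => //.
    by rewrite -ltnS ltn_neqAle ik1.
  have mphi' : measurable_fun setT (fun w : T => phi' (trajectory w)).
    apply: (measurable_history_lipschitz sepX _ lphi' mtraj).
    exact: ltW.
  have WZ A B : measurable A -> measurable B ->
      P ((W @^-1` A) `&` (eps k.+2 @^-1` B)) =
      (P (W @^-1` A) * P (eps k.+2 @^-1` B))%E.
    move=> mA mB; rewrite !preimage_id.
    exact: (history_independent eps_indep X1_indep (ltn0Sn k) mA mB).
  have KM : K j * M <= m.
    by rewrite mulrC ler_wpM2l ?(ltW M_gt0)// geometric_sum_le// -jk leq_addr.
  have := @step_concentration _ _ _ _ _ _ _ W (eps k.+2) WZ C M V2 m (K j) sepY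
    C_ge0 (ctlY (ltn0Sn _)) L0 m0 KM Phi mPhi lPhi mphi' iphi' a b c t
    (\int[P]_w phi' (trajectory w)) c0 q0 qexp k.+1 _ erefl phi'_ae phi'_mgf.
  rewrite (_ : \int[P]_w Phi (W w) (eps k.+2 w) = e); last first.
    by congr Rintegral; apply/funext => w; rewrite phiE.
  case=> iphi -> phi_ae phi_mgf; split => //.
  + apply: eq_integrable iphi => // w _ /=.
    by rewrite phiE.
  + by apply: ae_imply phi_ae => w; rewrite phiE.
  + under eq_integral do rewrite phiE.
    apply: le_trans phi_mgf _; rewrite lee_fin big_ord_recl/= addn0.
    rewrite le_eqVlt; apply/orP; left; apply/eqP.
    rewrite mulrCA; congr (_ * (_ * _)).
    by apply: eq_bigr => i _; rewrite /bump /= add1n addSnnS.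
Qed.

End chain.

(** * The tail bound *)

Lemma sum_shift_rev (R : realType) (G : nat -> R) (k : nat) :
  \sum_(2 <= i < k.+2) G (k.+1 - i)%N = \sum_(i < k) G i.
Proof.
rewrite big_nat_rev/= -{1}[2%N]add0n big_addn subn2 big_mkord.
apply: eq_bigr => i _; congr G; have := ltn_ord i.
by move: (i : nat) => j /=; lia.
Qed.

Lemma Hfun_ge0 (R : realType) n (x v : R) : 0 <= Hfun n x v.
Proof. by rewrite /Hfun; case: ifP => // _; exact: powR_ge0. Qed.

(** The factors are affine in the variances and have mean a + c s. *)
Lemma prod_parabola_le (R : realType) (a c B V1 s : R) (k : nat)
    (sigma : 'I_k -> R) : 0 <= a -> 0 <= c -> a + c * s = B -> 0 <= V1 ->
  (forall i, 0 <= sigma i) -> V1 + \sum_(i < k) sigma i = k.+1%:R * s ->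
  (a + c * V1) * \prod_(i < k) (a + c * sigma i) <= B ^+ k.+1.
Proof.
move=> a0 c0 <- V10 sigma0 sE.
pose E (i : 'I_k.+1) :=
  a + c * (if unlift ord0 i is Some j then sigma j else V1).
have E0 : {in predT, forall i, 0 <= E i}.
  by move=> i _; rewrite /E addr_ge0// mulr_ge0//; case: unlift.
have := (leif_AGM (A := predT) E0).1.
rewrite big_ord_recl/= {1}/E unlift_none.
under eq_bigr do rewrite /E liftK.
move=> /le_trans; apply.
rewrite big_ord_recl/= {1}/E unlift_none.
under eq_bigr do rewrite /E liftK.
rewrite cardT size_enum_ord big_split/= sumr_const card_ord -mulr_sumr.
rewrite -[_ *+ k]mulr_natr le_eqVlt; apply/orP; left; apply/eqP; congr (_ ^+ _).
have -> : a + c * V1 + (a * k%:R + c * \sum_(i < k) sigma i) =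
    a * k.+1%:R + c * (V1 + \sum_(i < k) sigma i) by rewrite -natr1; ring.
by rewrite sE; field; rewrite gt_eqF// ltr_pwDl.
Qed.

Lemma exponential_markov d (Omega : measurableType d) (R : realType)
    (P : probability Omega R) (xi : Omega -> R) (t y : R) :
  measurable_fun setT xi -> 0 <= t ->
  (P [set w | (y < xi w)%R] <=
   (expR (- (t * y)))%:E * \int[P]_w (expR (t * xi w))%:E)%E.
Proof.
move=> mxi t0.
have mA : measurable [set w | y < xi w].
  rewrite [X in measurable X](_ : _ = xi @^-1` `]y, +oo[%classic).
    by rewrite -[X in measurable X]setTI; exact: mxi.
  by apply/seteqP; split => w /=; rewrite in_itv/= andbT.
have mexp : measurable_fun setT (fun w => (expR (t * xi w))%:E).
  apply/measurable_EFinP; apply: (measurableT_comp (@measurable_expR R)).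
  exact: measurable_funM.
rewrite -(setIT [set w | y < xi w]) -integral_indic// -ge0_integralZl//.
apply: ge0_le_integral => //.
- by apply/measurable_EFinP; exact: measurable_indic.
- by apply: emeasurable_funM.
- move=> w _; rewrite -EFinM lee_fin -expRD indicE; case: (boolP (_ \in _)).
    rewrite inE /= => yxi; rewrite -expR0 ler_expR addrC -mulrBr.
    by rewrite mulr_ge0// subr_ge0 ltW.
  by rewrite expR_ge0.
Qed.

Section one_sided.
Context (R : realType) (X Y : completeMetricType R) (d : measure_display)
  (Omega : measurableType d) (P : probability Omega R).
Variables (F : borelType X * borelType Y -> borelType X) (rho C : R).
Hypothesis sepX : separable X.
Hypothesis sepY : separable Y.
Hypothesis mF : measurable_fun setT F.
Hypothesis rho_ge0 : 0 <= rho.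
Hypothesis C_ge0 : 0 <= C.
Hypothesis F_lip : forall (x : X) (y y' : Y),
  mdist (F (x, y) : X) (F (x, y') : X) <= C * mdist y y'.
Variables (eps : nat -> {RV P >-> borelType Y})
  (Xs : nat -> {RV P >-> borelType X}).
Hypothesis eps_indep : mutually_independent [set i | (1 <= i)%N] eps.
Hypothesis X1_indep : independent_of_family (Xs 1%N) [set i | (2 <= i)%N] eps.
Hypothesis Xs_rec : forall k, (2 <= k)%N ->
    forall w, Xs k w = F (Xs k.-1 w, eps k w).
Variables (M V1 V2 : R).
Hypothesis M_gt0 : 0 < M.
Hypothesis V1_gt0 : 0 < V1.
Hypothesis V2_gt0 : 0 < V2.
Hypothesis ctlX : controlled_law (distribution P (Xs 1%N)) 1 M V1.
Hypothesis ctlY : forall k, (1 <= k)%N ->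
  controlled_law (distribution P (eps k)) C M V2.
Hypothesis contr : forall k, (1 <= k)%N -> forall x x' : X,
  \int[distribution P (eps k)]_y mdist (F (x, y) : X) (F (x', y) : X) <=
  rho * mdist x x'.
Variables (k : nat) (phi : (nat -> X) -> R).
Hypothesis lphi : history_lipschitz k 1 phi.

Let K := geometric_sum rho.
Let trajectory (w : Omega) : nat -> X := fun i => Xs i.+1 w.
Let e := \int[P]_w phi (trajectory w).
Let m := M * K k.
Let V := V1 * K k ^+ 2 + V2 * \sum_(2 <= i < k.+2) K (k.+1 - i)%N ^+ 2.
Let xi w := (phi (trajectory w) - e) / m.

Let m_gt0 : 0 < m.
Proof. by rewrite mulr_gt0// geometric_sum_gt0. Qed.

Let concentration a b c t (c0 : 0 <= c)
  (q0 : forall x, 0 <= a + b * x + c * x ^+ 2)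
  (qexp : forall x, x <= 1 -> expR (t * x) <= a + b * x + c * x ^+ 2) :=
  chain_concentration sepX sepY mF rho_ge0 C_ge0 F_lip eps_indep X1_indep
    Xs_rec M_gt0 ctlX ctlY contr c0 q0 qexp (add0n k) (phi := phi).

Let lphi0 : history_lipschitz k (K 0) phi.
Proof. by rewrite /K geometric_sum0. Qed.

Let integrable_ae : P.-integrable setT (fun w => (phi (trajectory w))%:E) /\
  {ae P, forall w, `|phi (trajectory w) - e| <= k.+1%:R * m}.
Proof.
(* At t = 0 the constant 1 is an admissible parabola. *)
have q0 (x : R) : 0 <= 1 + 0 * x + 0 * x ^+ 2 by rewrite !mul0r !addr0.
have qexp (x : R) : x <= 1 -> expR (0 * x) <= 1 + 0 * x + 0 * x ^+ 2.
  by rewrite !mul0r !addr0 expR0.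
by have [? ? _] := concentration (lexx 0) q0 qexp lphi0.
Qed.

Lemma chain_integrable : P.-integrable setT (fun w => (phi (trajectory w))%:E).
Proof. by have [] := integrable_ae. Qed.

Let mphi : measurable_fun setT (fun w => phi (trajectory w)).
Proof. by apply/measurable_EFinP; exact: measurable_int chain_integrable. Qed.

Let mxi : measurable_fun setT xi.
Proof. by apply: measurable_funM => //; exact: measurable_funB. Qed.

Let V_gt0 : 0 < V.
Proof.
rewrite ltr_pwDl ?mulr_gt0 ?exprn_gt0 ?geometric_sum_gt0//.
by rewrite mulr_ge0 ?(ltW V2_gt0)// sumr_ge0// => i _; rewrite sqr_ge0.
Qed.

(* Each of the k + 1 normalized differences is almost surely at most 1. *)
Let beyond_range y : k.+1%:R <= y -> P [set w | y < xi w] = 0%E.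
Proof.
move=> ky; have [_ [N [mN N0 AN]]] := integrable_ae.
apply/eqP; rewrite eq_le measure_ge0 andbT -N0; apply: le_measure;
  rewrite ?inE//.
  rewrite [X in measurable X](_ : _ = xi @^-1` `]y, +oo[%classic).
    by rewrite -[X in measurable X]setTI; exact: mxi.
  by apply/seteqP; split => w /=; rewrite in_itv/= andbT.
move=> w /= yw; apply: AN => /= h; move: yw; apply/negP; rewrite -leNgt.
apply: le_trans ky; rewrite /xi ler_pdivrMr//.
exact: le_trans (ler_norm _) h.
Qed.

(** The variance s of the two-point law is the average of the k + 1 bounds on
the conditional variances, so that (k + 1) s is the square of sqrt V / m. *)
Lemma one_sided_tail x : 0 < x ->
  (P [set w | (x < phi (trajectory w) - e)%R] <=
   (Hfun k.+1 (x / m) (Num.sqrt V / m))%:E)%E.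
Proof.
move=> x0.
have -> : [set w | x < phi (trajectory w) - e] = [set w | x / m < xi w].
  by apply/seteqP; split => w /=; rewrite /xi ltr_pM2r ?invr_gt0.
have [nx|xn] := leP k.+1%:R (x / m).
  by rewrite beyond_range// lee_fin Hfun_ge0.
pose s := V / m ^+ 2 / k.+1%:R.
have s0 : 0 < s by rewrite !divr_gt0// exprn_gt0.
have vs : (Num.sqrt V / m) ^+ 2 = k.+1%:R * s.
  by rewrite expr_div_n sqr_sqrtr ?ltW// /s [RHS]mulrC divfK// pnatr_eq0.
have [t t0 <-] := Hfun_chernoff (ltn0Sn k) s0 vs (divr_gt0 x0 m_gt0) xn.
have [a [b [c [c0 acs q0 qexp]]]] := expR_le_parabola s0 (ltW t0).
have [_ _ mgf] := concentration c0 q0 qexp lphi0.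
apply: le_trans (exponential_markov _ _ mxi (ltW t0)) _.
rewrite EFinM; apply: lee_wpmul2l; first by rewrite lee_fin expR_ge0.
apply: le_trans mgf _; rewrite lee_fin; apply: prod_parabola_le c0 acs _ _ _.
- by have := q0 0; rewrite mulr0 expr0n/= mulr0 !addr0.
- by rewrite divr_ge0 ?sqr_ge0// mulr_ge0 ?sqr_ge0// ltW.
- by move=> i; rewrite divr_ge0 ?sqr_ge0// mulr_ge0 ?sqr_ge0// ltW.
- rewrite -vs expr_div_n sqr_sqrtr ?ltW// /V.
  rewrite (sum_shift_rev (fun i => K i ^+ 2)).
  rewrite -mulr_suml -mulr_suml -mulrDl; congr (_ / _).
  by rewrite mulrC; congr (_ + _); rewrite mulrC.
Qed.

End one_sided.

Theorem proposition3p8 (R : realType) (X Y : completeMetricType R)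
  (sepX : separable X) (sepY : separable Y)
  (d : measure_display) (Omega : measurableType d) (P : probability Omega R)
  (* the sequences are indexed from 1; their values at 0 play no role *)
  (eps : nat -> {RV P >-> borelType Y})
  (eps_indep : mutually_independent [set i | (1 <= i)%N] eps)
  (eps_id : identically_distributed [set i | (1 <= i)%N] eps)
  (F : borelType X * borelType Y -> borelType X)
  (mF : measurable_fun setT F)
  (Xs : nat -> {RV P >-> borelType X})
  (X1_indep : independent_of_family (Xs 1%N) [set i | (2 <= i)%N] eps)
  (Xs_rec : forall k, (2 <= k)%N ->
    forall w, Xs k w = F (Xs k.-1 w, eps k w))
  (rho C : R) (rho_ge0 : 0 <= rho) (rho_lt1 : rho < 1) (C_gt0 : 0 < C)
  (F_contr : forall x x' : X,
    ('E_P[fun w => mdist (F (x, eps 1%N w) : X) (F (x', eps 1%N w) : X)]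
      <= (rho * mdist x x')%:E)%E)
  (F_lip : forall (x : X) (y y' : Y),
    mdist (F (x, y) : X) (F (x, y') : X) <= C * mdist y y')
  (n : nat) (n_ge1 : (1 <= n)%N) (f : n.-tuple X -> R)
  (f_lip : forall s t : n.-tuple X,
    `|f s - f t| <= \sum_(i < n) mdist (tnth s i) (tnth t i))
  (M V1 V2 : R) (M_gt0 : 0 < M) (V1_gt0 : 0 < V1) (V2_gt0 : 0 < V2)
  (GX_le : {ae P, forall w, (mean_distance 1 (Xs 1%N) (Xs 1%N w) <= M%:E)%E})
  (Geps_le : {ae P, forall w,
    (mean_distance C (eps 1%N) (eps 1%N w) <= M%:E)%E})
  (GX_sq : (\int[P]_w (mean_distance 1 (Xs 1%N) (Xs 1%N w)) ^+ 2
    <= V1%:E)%E)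
  (Geps_sq : (\int[P]_w (mean_distance C (eps 1%N) (eps 1%N w)) ^+ 2
    <= V2%:E)%E)
  (x : R) (x_gt0 : 0 < x) :
  let K := geometric_sum rho in
  let S := centered P (fun w => f [tuple (Xs i.+1 w : X) | i < n]) in
  let V := V1 * K n.-1 ^+ 2 + V2 * \sum_(2 <= i < n.+1) K (n - i)%N ^+ 2 in
  let bound := Hfun n (x / (M * K n.-1)) (Num.sqrt V / (M * K n.-1)) in
  (P [set w | (x < S w)%R] <= bound%:E)%E /\
  (P [set w | (x < - S w)%R] <= bound%:E)%E.
Proof.
move=> K S V bound.
case: n n_ge1 f f_lip @S @V @bound => // k _ g g_lip S V bound /=.
have C_ge0 := ltW C_gt0.
have ctlX := controlled_law_distribution sepX ler01 GX_le GX_sq.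
have epsE i : (1 <= i)%N -> forall A : set (borelType Y), measurable A ->
    distribution P (eps 1%N) A = distribution P (eps i) A.
  by move=> i1 A mA; exact: eps_id.
have ctlY i : (1 <= i)%N -> controlled_law (distribution P (eps i)) C M V2.
  move=> i1; apply: controlled_law_eq (epsE i i1) _.
  exact: controlled_law_distribution.
have contr i : (1 <= i)%N -> forall x x' : X,
    \int[distribution P (eps i)]_y mdist (F (x, y) : X) (F (x', y) : X) <=
    rho * mdist x x'.
  move=> i1 y y'; rewrite /Rintegral.
  rewrite (eq_measure_integral (distribution P (eps 1%N))); last first.
    by move=> A mA _; exact/esym/epsE.
  have mdF : measurable_fun setT
      (fun z : borelType Y => (mdist (F (y, z) : X) (F (y', z) : X))%:E).
    apply/measurable_EFinP.
    apply: (@lipschitz_measurable _ _ C sepY C_ge0 _ 2) => // z z'.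
    exact: noise_mdist_lipschitz.
  rewrite (ge0_integral_distribution (eps 1%N) mdF); last first.
    by move=> z; rewrite lee_fin mdist_ge0.
  have := F_contr y y'; rewrite unlock => h.
  rewrite -lee_fin fineK//.
  rewrite ge0_fin_numE ?(le_lt_trans h) ?ltry//.
  by apply: integral_ge0 => w _; rewrite lee_fin mdist_ge0.
have tail (h : k.+1.-tuple X -> R) :
    (forall s t, `|h s - h t| <= \sum_(i < k.+1) mdist (tnth s i) (tnth t i)) ->
  P.-integrable setT (fun w => (h [tuple (Xs i.+1 w : X) | i < k.+1])%:E) /\
  (P [set w | (x < h [tuple (Xs i.+1 w : X) | i < k.+1] -
      \int[P]_w h [tuple (Xs i.+1 w : X) | i < k.+1])%R] <= bound%:E)%E.
  move=> h_lip.
  pose phi (u : nat -> X) := h [tuple u i | i < k.+1].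
  have lphi : history_lipschitz k 1 phi.
    move=> u u'; apply: le_trans (h_lip _ _) _; rewrite mul1r big_ord_recr/=.
    rewrite le_eqVlt; apply/orP; left; apply/eqP; congr (_ + _).
      by apply: eq_bigr => i _; rewrite !tnth_mktuple.
    by rewrite !tnth_mktuple.
  split.
    exact: (chain_integrable sepX sepY mF rho_ge0 C_ge0 F_lip eps_indep
      X1_indep Xs_rec M_gt0 ctlX ctlY contr lphi).
  exact: (one_sided_tail sepX sepY mF rho_ge0 C_ge0 F_lip eps_indep
    X1_indep Xs_rec M_gt0 V1_gt0 V2_gt0 ctlX ctlY contr lphi x_gt0).
have [ig tg] := tail g g_lip.
have SE w : S w = g [tuple (Xs i.+1 w : X) | i < k.+1] -
    \int[P]_w g [tuple (Xs i.+1 w : X) | i < k.+1].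
  by rewrite /S /centered unlock.
have {}SE := funext SE. rewrite SE.
split => //.
(* The lower tail is the upper tail of the opposite functional. *)
have [s t|_ tNg] := tail (fun s => - g s).
  by rewrite -opprD normrN.
apply: le_trans tNg.
rewrite le_eqVlt; apply/orP; left; apply/eqP; congr (P _).
have -> : \int[P]_w - g [tuple (Xs i.+1 w : X) | i < k.+1] =
    - \int[P]_w g [tuple (Xs i.+1 w : X) | i < k.+1].
  under [LHS]eq_Rintegral do rewrite -mulN1r.
  by rewrite (RintegralZl _ measurableT ig) mulN1r.
by apply/seteqP; split => w /=; rewrite opprB opprK addrC.
Qed.
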